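(* Let $k$ be a positive integer and let $\{a_n\}_{n\geq k}$ be a sequence of positive real numbers. If $\{a_n\}_{n\geq k}$ is ratio log-convex and \[\frac{\sqrt[k+1]{a_{k+1}}}{\sqrt[k]{a_k}}< \frac{\sqrt[k+2]{a_{k+2}}}{\sqrt[k+1]{a_{k+1}}},\] then the sequence $\{\sqrt[n]{a_n}\}_{n\geq k}$ is strictly log-convex.
   Context: A sequence $(x_n)_{n\ge m}$ of positive reals is log-convex if $x_n^2\le x_{n-1}x_{n+1}$ for all $n\ge m+1$, strictly log-convex if the inequality is strict. A sequence $(a_n)_{n\ge m}$ of positive reals is ratio log-convex if $(a_{n+1}/a_n)_{n\ge m}$ is log-convex. *)

(* Defs.v *)
(* Sequences (x_n)_{n >= m} are total functions nat -> R of which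
   only the values at indices n >= m are constrained. *)
From Stdlib Require Import Reals Lra Lia.
Open Scope R_scope.

Definition positive_from (m : nat) (x : nat -> R) : Prop :=
  forall n : nat, (m <= n)%nat -> 0 < x n.

(* In the two definitions below n >= m + 1 >= 1, so n - 1 is not truncated. *)
Definition log_convex_from (m : nat) (x : nat -> R) : Prop :=
  positive_from m x /\
  forall n : nat, (m + 1 <= n)%nat -> x n ^ 2 <= x (n - 1)%nat * x (n + 1)%nat.

Definition strictly_log_convex_from (m : nat) (x : nat -> R) : Prop :=
  positive_from m x /\
  forall n : nat, (m + 1 <= n)%nat -> x n ^ 2 < x (n - 1)%nat * x (n + 1)%nat.

Definition ratio_log_convex_from (m : nat) (a : nat -> R) : Prop :=
  positive_from m a /\
  log_convex_from m (fun n => a (n + 1)%nat / a n).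

(* Only meaningful for n >= 1 and x > 0; see nth_root_pos and nth_root_pow. *)
Definition nth_root (n : nat) (x : R) : R := Rpower x (/ INR n).

Lemma nth_root_pos (n : nat) (x : R) : 0 < nth_root n x.
Proof. apply exp_pos. Qed.

Lemma nth_root_pow (n : nat) (x : R) :
  (1 <= n)%nat -> 0 < x -> nth_root n x ^ n = x.
Proof.
intros hn hx.
rewrite <- Rpower_pow by apply nth_root_pos.
unfold nth_root; rewrite Rpower_mult, Rinv_l.
- now apply Rpower_1.
- apply not_0_INR; lia.
Qed.

(* Main.v *)
Require Import Defs.
From Stdlib Require Import Reals Lra Lia.
Open Scope R_scope.

(** Put [L n = ln (a n)].  Strict log-convexity of the roots at [n + 1] says that
    the second difference of [L n / n] is positive there; after clearing
    denominators this is the positivity of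
    [E n = n (n+1) L (n+2) - 2 n (n+2) L (n+1) + (n+1) (n+2) L n].
    Now [E (n+1) - E n] equals [(n+1) (n+2)] times the third difference of [L],
    which is nonnegative exactly because [a] is ratio log-convex.  So [E] is
    nondecreasing, and it is positive at [k] by the initial inequality. *)

Definition root_defect (L : nat -> R) (n : nat) : R :=
  INR n * (INR n + 1) * L (n + 2)%nat
  - 2 * INR n * (INR n + 2) * L (n + 1)%nat
  + (INR n + 1) * (INR n + 2) * L n.

Lemma root_defect_step (L : nat -> R) (n : nat) :
  root_defect L (n + 1) - root_defect L n
  = (INR n + 1) * (INR n + 2)
    * (L (n + 3)%nat - 3 * L (n + 2)%nat + 3 * L (n + 1)%nat - L n).
Proof.
unfold root_defect.
replace (n + 1 + 2)%nat with (n + 3)%nat by lia.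
replace (n + 1 + 1)%nat with (n + 2)%nat by lia.
rewrite plus_INR; simpl (INR 1); ring.
Qed.

Lemma root_defect_positive_from (L : nat -> R) (k : nat) :
  (forall n, (k <= n)%nat ->
     0 <= L (n + 3)%nat - 3 * L (n + 2)%nat + 3 * L (n + 1)%nat - L n) ->
  0 < root_defect L k ->
  positive_from k (root_defect L).
Proof.
intros hdiff h0 n hn; induction hn as [|n hn IH]; [exact h0|].
pose proof (root_defect_step L n) as hstep.
(* Induction on [k <= n] yields [S n]; only the argument of [root_defect] is changed, so that the
   third difference keeps the form used in [hdiff]. *)
replace (n + 1)%nat with (S n) in hstep at 1 by lia.
assert (hn0 := pos_INR n).
assert (0 <= (INR n + 1) * (INR n + 2)
          * (L (n + 3)%nat - 3 * L (n + 2)%nat + 3 * L (n + 1)%nat - L n)).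
{ apply Rmult_le_pos; [nra | now apply hdiff]. }
lra.
Qed.

(** Both sides are exponentials, and the difference of their exponents is the defect divided by
    [n (n+1) (n+2)], which is positive. *)
Lemma nth_root_sqr_lt_iff (a : nat -> R) (n : nat) : (1 <= n)%nat ->
  nth_root (n + 1) (a (n + 1)%nat) ^ 2
    < nth_root n (a n) * nth_root (n + 2) (a (n + 2)%nat)
  <-> 0 < root_defect (fun i => ln (a i)) n.
Proof.
intros hn.
assert (hx : 1 <= INR n) by (apply le_INR in hn; simpl in hn; lra).
assert (hprod : 0 < INR n * (INR n + 1) * (INR n + 2)).
{ repeat apply Rmult_lt_0_compat; lra. }
assert (hE : root_defect (fun i => ln (a i)) n
  = INR n * (INR n + 1) * (INR n + 2)
    * ((/ INR n * ln (a n) + / (INR n + 2) * ln (a (n + 2)%nat))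
       - 2 * (/ (INR n + 1) * ln (a (n + 1)%nat)))).
{ unfold root_defect; field; lra. }
unfold nth_root, Rpower; rewrite !plus_INR; simpl (INR 1); simpl (INR 2).
replace (1 + 1) with 2 by ring.
simpl (_ ^ 2); rewrite Rmult_1_r, <- !exp_plus, hE.
split; intros h.
- apply exp_lt_inv in h.
  apply Rmult_lt_0_compat; lra.
- apply exp_increasing.
  apply Rmult_lt_reg_l with (1 := hprod); lra.
Qed.

(** Log-convexity of the ratios at [n + 1] involves [a n] to [a (n+3)]; its logarithm is a second
    difference of first differences of [ln a]. *)
Lemma ratio_log_convex_third_difference (k : nat) (a : nat -> R) :
  ratio_log_convex_from k a -> forall n, (k <= n)%nat ->
  0 <= ln (a (n + 3)%nat) - 3 * ln (a (n + 2)%nat)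
       + 3 * ln (a (n + 1)%nat) - ln (a n).
Proof.
intros [hpos [_ hlc]] n hn.
specialize (hlc (n + 1)%nat ltac:(lia)); simpl (_ ^ 2) in hlc.
replace (n + 1 - 1)%nat with n in hlc by lia.
replace (n + 1 + 1)%nat with (n + 2)%nat in hlc by lia.
replace (n + 2 + 1)%nat with (n + 3)%nat in hlc by lia.
rewrite Rmult_1_r in hlc.
assert (h0 := hpos n ltac:(lia)).
assert (h1 := hpos (n + 1)%nat ltac:(lia)).
assert (h2 := hpos (n + 2)%nat ltac:(lia)).
assert (h3 := hpos (n + 3)%nat ltac:(lia)).
assert (q0 := Rdiv_lt_0_compat _ _ h1 h0).
assert (q1 := Rdiv_lt_0_compat _ _ h2 h1).
assert (q2 := Rdiv_lt_0_compat _ _ h3 h2).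
assert (hln : ln (a (n + 2)%nat / a (n + 1)%nat * (a (n + 2)%nat / a (n + 1)%nat))
  <= ln (a (n + 1)%nat / a n * (a (n + 3)%nat / a (n + 2)%nat))).
(* [ln_increasing] is strict, so equality is treated apart. *)
{ destruct hlc as [hlt | heq]; [left | right; now rewrite heq].
  apply ln_increasing; [now apply Rmult_lt_0_compat | exact hlt]. }
unfold Rdiv in *.
rewrite !ln_mult, !ln_Rinv in hln by auto using Rinv_0_lt_compat.
lra.
Qed.

Theorem theorem3p6 (k : nat) (hk : (1 <= k)%nat) (a : nat -> R)
  (ha : positive_from k a)
  (hrlc : ratio_log_convex_from k a)
  (hinit : nth_root (k + 1) (a (k + 1)%nat) / nth_root k (a k)
           < nth_root (k + 2) (a (k + 2)%nat) / nth_root (k + 1) (a (k + 1)%nat)) :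
  strictly_log_convex_from k (fun n => nth_root n (a n)).
Proof.
assert (h0 : 0 < root_defect (fun i => ln (a i)) k).
{ apply nth_root_sqr_lt_iff; [exact hk|].
  assert (p0 := nth_root_pos k (a k)).
  assert (p1 := nth_root_pos (k + 1) (a (k + 1)%nat)).
  (* Multiplying by the product of both denominators turns the ratio inequality into the
     log-convexity inequality centred at [k + 1]. *)
  apply Rmult_lt_compat_l with (1 := Rmult_lt_0_compat _ _ p0 p1) in hinit.
  field_simplify in hinit; lra. }
split; [intros n _; apply nth_root_pos|].
intros n hn.
(* The defect is indexed by the left end of the triple, here [n - 1], which is at least [k]. *)
replace n with (n - 1 + 1)%nat at 1 2 by lia.
replace (n + 1)%nat with (n - 1 + 2)%nat by lia.
apply nth_root_sqr_lt_iff; [lia|].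
apply root_defect_positive_from with (k := k); [|exact h0|lia].
now apply ratio_log_convex_third_difference.
Qed.
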